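(* Let $p>1$ be a real number and let $\alpha\ge0$ be a real number with $\alpha\neq p-1$. There exists a positive weight $\mathcal{R}_\alpha:\mathbb{N}^*\to(0,\infty)$ such that for all $u\in H^1_0(\mathbb{N})$, $$\sum_{n=1}^\infty|u_n-u_{n-1}|^p\,n^\alpha-\mathcal{A}^{\mathrm{disc}}_{\alpha,p}\sum_{n=1}^\infty|u_n|^p\,n^{\alpha-p}\ge\sum_{n=1}^\infty|u_n|^p\,\mathcal{R}_\alpha(n).$$ In particular, the energy functional $$h_\alpha(u)=\sum_{n=1}^\infty|u_n-u_{n-1}|^p\,n^\alpha-\mathcal{A}^{\mathrm{disc}}_{\alpha,p}\sum_{n=1}^\infty|u_n|^p\,n^{\alpha-p},\qquad u\in H^1_0(\mathbb{N}),$$ is subcritical, and the inequality $$\mathcal{A}^{\mathrm{disc}}_{\alpha,p}\sum_{n=1}^\infty|u_n|^p\,n^{\alpha-p}\le\sum_{n=1}^\infty|u_n-u_{n-1}|^p\,n^\alpha,\qquad u\in H^1_0(\mathbb{N}),$$ is $\Psi$-stable with $\Psi(t)=t^p$.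
   Context: $\mathbb{N}^*=\{1,2,\dots\}$. $H^1_0(\mathbb{N})$ denotes the space of finitely supported real sequences $u=(u_n)_{n\ge0}$ with $u_0=0$. $\mathcal{A}^{\mathrm{disc}}_{\alpha,p}$ denotes the sharp (largest) constant such that $\sum_{n=1}^\infty|u_n-u_{n-1}|^p n^\alpha\ge\mathcal{A}^{\mathrm{disc}}_{\alpha,p}\sum_{n=1}^\infty|u_n|^p n^{\alpha-p}$ for all $u\in H^1_0(\mathbb{N})$; for $\alpha\ge0$, $\alpha\ne p-1$, it equals $\left|\frac{\alpha-p+1}{p}\right|^p$. Subcriticality: $h_\alpha$ is subcritical if there exists a positive function $w$ on $\mathbb{N}^*$ such that $h_\alpha(u)-\sum_{n=1}^\infty|u_n|^p w(n)\ge0$ for all $u\in H^1_0(\mathbb{N})$. Stability: let $X$ be a real normed linear space and $\mathcal{E},\mathcal{F}:X\to\mathbb{R}\cup\{\infty\}$ with $\mathcal{E}(x)\le\mathcal{F}(x)$ for all $x\in X$. Put $X_{\mathrm{opt}}=\{x\in X:\mathcal{E}(x)=\mathcal{F}(x),\ \mathcal{F}(x)<\infty\}$. A rate function is a strictly convex map $\Psi:[0,\infty)\to[0,\infty)$ vanishing at $0$. For a metric $d$ on $X$ (possibly different from the norm metric), the inequality $\mathcal{E}\le\mathcal{F}$ is called $(d,\Psi)$-stable if $\mathcal{F}(x)-\mathcal{E}(x)\ge\Psi(d(x,X_{\mathrm{opt}}))$ for all $x\in X$; it is called $\Psi$-stable if it is $(d,\Psi)$-stable for some metric $d$ on $X$.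 Here $X=H^1_0(\mathbb{N})$, $\mathcal{E}(u)=\mathcal{A}^{\mathrm{disc}}_{\alpha,p}\sum_{n\ge1}|u_n|^p n^{\alpha-p}$ and $\mathcal{F}(u)=\sum_{n\ge1}|u_n-u_{n-1}|^p n^\alpha$. *)

(* Defs.v *)
From HB Require Import structures.
From mathcomp Require Import all_boot all_order all_algebra.
From mathcomp Require Import all_classical all_reals all_analysis.

Set Implicit Arguments.
Unset Strict Implicit.
Unset Printing Implicit Defensive.

Import Order.TTheory GRing.Theory Num.Theory.

Local Open Scope classical_set_scope.
Local Open Scope ring_scope.

Section H10.
Variable R : realType.

Definition finsupp0 : {pred nat -> R} :=
  mem [set u : nat -> R |
    u 0%N = 0 /\ exists N, forall n, (N <= n)%N -> u n = 0].

Record H10 := MkH10 { H10_val :> nat -> R; _ : H10_val \in finsupp0 }.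

HB.instance Definition _ := [isSub for H10_val].
HB.instance Definition _ := [Choice of H10 by <:].

Lemma finsupp0_submod_closed : submod_closed finsupp0.
Proof.
split; first by rewrite inE /=; split => //; exists 0%N.
move=> a u v; rewrite !inE /= => -[u0 [M uM]] [v0 [N vN]].
have E n : (a *: u + v) n = a * u n + v n by [].
split; first by rewrite E u0 v0 mulr0 addr0.
exists (maxn M N) => n; rewrite geq_max => /andP[Mn Nn].
by rewrite E uM// vN// mulr0 addr0.
Qed.

HB.instance Definition _ := GRing.isSubmodClosed.Build R (nat -> R) finsupp0
  finsupp0_submod_closed.
HB.instance Definition _ := [SubChoice_isSubLmodule of H10 by <:].

End H10.

Section stability.
Variables (R : realType) (X : lmodType R).
(* The norm of the ambient space plays no role in the notions below, so only
   the linear structure is required. *)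

Definition is_metric (d : X -> X -> R) : Prop :=
  [/\ forall x y, 0 <= d x y,
      forall x y, d x y = 0 <-> x = y,
      forall x y, d x y = d y x &
      forall x y z, d x z <= d x y + d y z].

(* A map [0, oo) -> [0, oo) is encoded as a function on R whose values on
   negative arguments are irrelevant. *)
Definition rate_function (Psi : R -> R) : Prop :=
  [/\ forall t, 0 <= t -> 0 <= Psi t,
      Psi 0 = 0 &
      forall x y t, 0 <= x -> 0 <= y -> x != y -> 0 < t -> t < 1 ->
        Psi (t * x + (1 - t) * y) < t * Psi x + (1 - t) * Psi y].

Definition Xopt (E F : X -> \bar R) : set X :=
  [set x | E x = F x /\ (F x < +oo)%E].

(* +oo when A is empty *)
Definition dist_to (d : X -> X -> R) (x : X) (A : set X) : \bar R :=
  ereal_inf [set (d x y)%:E | y in A].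

(* E and F take values in R `|` {+oo}. When F x = +oo the stability estimate
   is either trivial or has the undefined right-hand side oo - oo, whence the
   restriction to F x < +oo. [er_map Psi] extends Psi by Psi(+oo) = +oo. *)
Definition dPsi_stable (d : X -> X -> R) (Psi : R -> R)
    (E F : X -> \bar R) : Prop :=
  [/\ rate_function Psi,
      forall x, (-oo < E x)%E,
      forall x, (E x <= F x)%E &
      forall x, (F x < +oo)%E ->
        (er_map Psi (dist_to d x (Xopt E F)) <= F x - E x)%E].

Definition Psi_stable (Psi : R -> R) (E F : X -> \bar R) : Prop :=
  exists d, is_metric d /\ dPsi_stable d Psi E F.

End stability.

Section hardy.
Variable R : realType.
Local Open Scope ereal_scope.

(* The series below have finitely many nonzero terms when u is in [H10 R], so
   their values are finite. *)
Definition wsum (p : R) (w : nat -> R) (u : nat -> R) : \bar R :=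
  \sum_(1 <= n <oo) (`|u n| `^ p * w n)%:E.

Definition energy (alpha p : R) (u : nat -> R) : \bar R :=
  \sum_(1 <= n <oo) (`|u n - u n.-1| `^ p * n%:R `^ alpha)%:E.

Definition hardy_sum (alpha p : R) (u : nat -> R) : \bar R :=
  wsum p (fun n => (n%:R `^ (alpha - p))%R) u.

(* This set of admissible constants contains 0, is closed, and is bounded
   above (test with the indicator of {1}), so its supremum is its maximum. *)
Definition hardy_const (alpha p : R) : R :=
  sup [set C : R | forall u : H10 R,
    C%:E * hardy_sum alpha p u <= energy alpha p u].

Definition hardy_E (alpha p : R) (u : H10 R) : \bar R :=
  (hardy_const alpha p)%:E * hardy_sum alpha p u.

Definition hardy_F (alpha p : R) (u : H10 R) : \bar R := energy alpha p u.

Definition h (alpha p : R) (u : H10 R) : \bar R :=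
  energy alpha p u - (hardy_const alpha p)%:E * hardy_sum alpha p u.

Definition subcritical (p : R) (f : H10 R -> \bar R) : Prop :=
  exists w : nat -> R, (forall n, (0 < n)%N -> (0 < w n)%R) /\
    forall u : H10 R, 0 <= f u - wsum p w u.

End hardy.

(* Main.v *)
(* Write c = |(alpha - p + 1) / p| ^ p.  Testing with n ^ ((p - 1 - alpha) / p)
   for n <= N, cut off linearly on [N, 2N], shows that the sharp constant is at
   most c: both sides grow like the harmonic sum.  Conversely, for 0 < d_n < 1,
   convexity of the p-th power gives on each edge (n - 1, n) an inequality
     |x - y| ^ p >= d_n ^ (p - 1) |x| ^ p - (d_n / (1 - d_n)) ^ (p - 1) |y| ^ p,
   with x, y the values at the two endpoints, in either order.  Multiplying by
   n ^ alpha and summing gives a Hardy inequality with an explicit weight.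
   Depending on the position of alpha, d_n is taken as follows:
     alpha < p - 1, b = (p - 1 - alpha) / p :
       d_n = b / (n - 1 + b);
     alpha > p - 1, g = (alpha - p + 1) / p <= 1 :
       d_n = (g / n) (1 - 1 / n) ^ (p g / (p - 1));
     alpha > p - 1, g >= 1 :
       d_n = g / (n + g).
   The resulting weight is strictly larger than c n ^ (alpha - p) at every n,
   and the difference is the weight W of the theorem.  For stability, 0 is then
   the only optimizer, and the metric is the l^p norm weighted by W. *)

Require Import Defs.
From mathcomp Require Import all_boot all_order all_algebra.
From mathcomp Require Import all_classical all_reals all_analysis.
From mathcomp Require Import ring lra.
Import Order.TTheory GRing.Theory Num.Theory.
Local Open Scope ring_scope.

(** * Bernoulli and convexity inequalities for real powers, and the scalar bounds behind the
    weights *)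

Section power_inequalities.
Set Implicit Arguments.
Unset Strict Implicit.
Context {R : realType}.
Implicit Types a b c d e h m p r s t x y z : R.

Lemma powR_expR x a : 0 < x -> x `^ a = expR (a * ln x).
Proof. by move=> x0; rewrite /powR gt_eqF. Qed.

Lemma ln_lt_sub1 x : 0 < x -> x != 1 -> ln x < x - 1.
Proof.
move=> x0 x1; rewrite -ltr_expR lnK ?posrE//.
have := @expR_gt1Dx R (x - 1); rewrite subr_eq0 => /(_ x1).
by rewrite addrC subrK.
Qed.

(** Strict Bernoulli inequality. When a = 1 + p (x - 1) is positive, split ln a - p ln x as (ln a -
    ln x) + (p - 1) (- ln x) and apply ln t <= t - 1 at a / x and at 1 / x; the two bounds add up to
    zero. *)
Lemma powR_gt_tangent p x : 1 < p -> 0 <= x -> x != 1 ->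
  1 + p * (x - 1) < x `^ p.
Proof.
move=> p1 x0 x1; have [a0|a0] := leP (1 + p * (x - 1)) 0.
  move: x0; rewrite le_eqVlt => /orP[/eqP xE|x0].
    by rewrite -xE powR0; [lra|apply/eqP; lra].
  exact: le_lt_trans a0 (powR_gt0 _ x0).
have {}x0 : 0 < x.
  by rewrite lt_neqAle x0 andbT; apply/eqP => xE; move: a0; rewrite -xE; lra.
rewrite (@powR_expR x)// -[ltLHS]lnK ?posrE// ltr_expR.
set a := 1 + _ in a0 *.
have ax : a / x != 1.
  apply/eqP => /(congr1 (fun z => z * x));
    rewrite mul1r divfK ?gt_eqF// /a => E.
  by case/eqP: x1; nra.
have L1 : ln a - ln x < a / x - 1.
  by rewrite -ln_div ?posrE// ln_lt_sub1// divr_gt0.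
have L2 : - ln x <= x^-1 - 1.
  have [->|xi1] := eqVneq x 1; first by rewrite ln1 invr1; lra.
  by rewrite -lnV ?posrE// ltW// ln_lt_sub1 ?invr_gt0// invr_eq1.
have E : a / x + (p - 1) * x^-1 = p by rewrite /a; field; rewrite gt_eqF.
have : (p - 1) * - ln x <= (p - 1) * (x^-1 - 1) by rewrite ler_wpM2l// subr_ge0
  ltW.
by move: L1 L2 E; set u := a / x; set v := x^-1; nra.
Qed.

Lemma powR_ge_tangent p x : 1 <= p -> 0 <= x -> 1 + p * (x - 1) <= x `^ p.
Proof.
rewrite le_eqVlt => /orP[/eqP <- x0|p1 x0]; first by rewrite powRr1//; lra.
have [->|x1] := eqVneq x 1; first by rewrite powR1; lra.
exact/ltW/powR_gt_tangent.
Qed.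

(** Bernoulli for the exponent 1/p at the point 1 + p (x - 1), raised back to the power p. *)
Lemma powR_le_tangent p x : 0 < p -> p <= 1 -> 0 <= 1 + p * (x - 1) -> 0 <= x ->
  x `^ p <= 1 + p * (x - 1).
Proof.
move=> p0 p1 y0 x0.
have pV : 1 <= p^-1 by rewrite invf_ge1.
have := powR_ge_tangent pV y0.
have -> : 1 + p^-1 * (1 + p * (x - 1) - 1) = x by field; rewrite gt_eqF.
move=> H.
have := ge0_ler_powR (ltW p0) _ _ H; rewrite !nnegrE powR_ge0 => /(_ x0 isT).
by rewrite -powRrM mulVf ?gt_eqF// powRr1.
Qed.

Lemma powR_gt_tangent_at p x z : 1 < p -> 0 <= x -> 0 < z -> x != z ->
  z `^ p + p * z `^ (p - 1) * (x - z) < x `^ p.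
Proof.
move=> p1 x0 z0 xz.
have g0 : 0 <= x / z by rewrite divr_ge0// ltW.
have g1 : x / z != 1.
  apply: contra xz => /eqP E; apply/eqP;
    rewrite -[RHS]mul1r -E divfK// gt_eqF//.
have := powR_gt_tangent p1 g0 g1.
rewrite -(ltr_pM2r (powR_gt0 p z0)) -powRM ?(ltW z0)// divfK ?gt_eqF//.
apply: le_lt_trans.
rewrite -(@mulr_powRB1 _ z p) ?(ltW z0)//; last lra.
by rewrite le_eqVlt; apply/orP; left; apply/eqP; field; rewrite gt_eqF.
Qed.

(** The tangent at the barycentre z lies strictly below the power at x and at y, and its linear
    terms cancel in the weighted sum. *)
Lemma powR_strictly_convex p x y t : 1 < p -> 0 <= x -> 0 <= y -> x != y ->
  0 < t -> t < 1 -> (t * x + (1 - t) * y) `^ p < t * x `^ p + (1 - t) * y `^ p.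
Proof.
move=> p1 x0 y0 xy t0 t1; set z := t * x + _.
have z0 : 0 < z.
  have [x00|x00] := eqVneq x 0; last first.
    have {}x0 : 0 < x by rewrite lt_neqAle eq_sym x00.
    by rewrite /z; nra.
  have {}y0 : 0 < y by rewrite lt_neqAle y0 andbT -x00.
  by rewrite /z; nra.
have xz : x != z by apply: contra xy => /eqP; rewrite /z => E; apply/eqP; nra.
have yz : y != z by apply: contra xy => /eqP; rewrite /z => E; apply/eqP; nra.
have := powR_gt_tangent_at p1 x0 z0 xz.
have := powR_gt_tangent_at p1 y0 z0 yz.
set k := p * _ => H1 H2.
have E : t * (x - z) + (1 - t) * (y - z) = 0 by rewrite /z; ring.
have E2 : t * (k * (x - z)) + (1 - t) * (k * (y - z)) = 0.
  by rewrite mulrCA [X in _ + X]mulrCA -mulrDr E mulr0.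
have t1' : 0 < 1 - t by lra.
move: H1 H2; rewrite -(ltr_pM2l t1') => H1; rewrite -(ltr_pM2l t0) => H2.
lra.
Qed.

Lemma powR_convex p x y t : 1 < p -> 0 <= x -> 0 <= y -> 0 < t -> t < 1 ->
  (t * x + (1 - t) * y) `^ p <= t * x `^ p + (1 - t) * y `^ p.
Proof.
move=> p1 x0 y0 t0 t1; have [->|xy] := eqVneq x y;
  last exact/ltW/powR_strictly_convex.
by rewrite -!mulrDl addrCA subrr addr0 !mul1r.
Qed.

(* Convexity of the p-th power at x + y = t (x / t) + (1 - t) (y / (1 - t)). *)
Lemma powR_addr_le p x y t : 1 < p -> 0 <= x -> 0 <= y -> 0 < t -> t < 1 ->
  (x + y) `^ p <= t `^ (1 - p) * x `^ p + (1 - t) `^ (1 - p) * y `^ p.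
Proof.
move=> p1 x0 y0 t0 t1.
have t'0 : 0 < 1 - t by lra.
have K s z : 0 < s -> 0 <= z -> s * (z / s) `^ p = s `^ (1 - p) * z `^ p.
  move=> s0 z0; rewrite powRM ?invr_ge0 ?(ltW s0)// -powR_inv1 ?(ltW s0)//
    -powRrM.
  rewrite mulN1r mulrCA mulrC; congr (_ * _).
  rewrite -{1}(@powRr1 _ s) ?(ltW s0)// -powRD// (gt_eqF s0) implybT//.
rewrite -!K//.
have := @powR_convex p (x / t) (y / (1 - t)) t p1.
rewrite !divr_ge0 ?(ltW t0) ?(ltW t'0)// => /(_ isT isT t0 t1).
by apply: le_trans; rewrite mulrC divfK ?gt_eqF// mulrC divfK ?gt_eqF.
Qed.

(** Apply [powR_addr_le] with t = d to |x| <= |x - y| + |y|, then multiply by d ^ (p - 1) so that |x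
    - y| ^ p gets coefficient 1. *)
Lemma picone_edge p d x y : 1 < p -> 0 < d -> d < 1 ->
  d `^ (p - 1) * `|x| `^ p <=
  `|x - y| `^ p + (d / (1 - d)) `^ (p - 1) * `|y| `^ p.
Proof.
move=> p1 d0 d1; have d'0 : 0 < 1 - d by lra.
have H : `|x| `^ p <= (`|x - y| + `|y|) `^ p.
  apply: ge0_ler_powR; rewrite ?nnegrE ?addr_ge0//; first lra.
  by rewrite -{1}(subrK y x) ler_normD.
have := le_trans H (powR_addr_le p1 (normr_ge0 (x - y)) (normr_ge0 y) d0 d1).
rewrite -(ler_pM2l (powR_gt0 (p - 1) d0)) => /le_trans; apply.
rewrite mulrDr !mulrA -powRD; last by rewrite (gt_eqF d0) implybT.
rewrite (_ : p - 1 + (1 - p) = 0) ?powRr0 ?mul1r; last ring.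
rewrite powRM ?invr_ge0 ?(ltW d0) ?(ltW d'0)// -(@powR_inv1 _ (1 - d)) ?(ltW
  d'0)// -powRrM.
by rewrite mulN1r opprB.
Qed.

(* The three scalar inequalities below are the strict lower bounds on the
   Hardy weights, in the variable h = 1/n. *)
Lemma weight_ineq_below p a h (b := (p - 1 - a) / p) :
  1 < p -> 0 <= a -> a < p - 1 -> 0 < h -> h <= 1 ->
  (1 + h) `^ a + b * h < (1 - (1 - b) * h) `^ (1 - p).
Proof.
move=> p1 a0 ap h0 h1.
have b0 : 0 < b by rewrite divr_gt0//; lra.
have pb : p * b = p - 1 - a by rewrite mulrC divfK//; apply/eqP; lra.
have b1 : b < 1 by nra.
have X0 : 0 < 1 - (1 - b) * h by nra.
have h1' : 0 < 1 + h by lra.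
rewrite !powR_expR//.
have lnX : ln (1 - (1 - b) * h) <= - ((1 - b) * h) by apply: le_ln1Dx; nra.
have lnh : ln (1 + h) <= h by apply: le_ln1Dx; lra.
(* Since p b = p - 1 - a, the product (p - 1) (1 - b) equals a + b, so the linear bounds on the two
   logarithms match exactly. *)
have e1 : expR (a * ln (1 + h)) * expR (b * h) <= expR ((1 - p) * ln (1 - (1 -
  b) * h)).
  rewrite -expRD ler_expR.
  have : (p - 1) * ln (1 - (1 - b) * h) <= (p - 1) * (- ((1 - b) * h)).
    by rewrite ler_pM2l//; lra.
  have : a * ln (1 + h) <= a * h by rewrite ler_wpM2l.
  nra.
apply: lt_le_trans e1.
have E1 : 1 <= expR (a * ln (1 + h)).
  by rewrite -[leLHS]expR0 ler_expR mulr_ge0// ln_ge0//; lra.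
have E2 : 1 + b * h < expR (b * h) by apply: expR_gt1Dx;
  rewrite gt_eqF// mulr_gt0.
apply: (@le_lt_trans _ _ (expR (a * ln (1 + h)) * (1 + b * h))).
  by rewrite mulrDr mulr1 lerD2l ler_peMl// mulr_ge0// ltW.
by rewrite ltr_pM2l ?expR_gt0.
Qed.

Lemma weight_ineq_above_small p g h : 1 < p -> 0 < g -> g <= 1 ->
  0 < h -> h < 1 ->
  ((1 - h) `^ (p * g / (p - 1)) / (1 - g * h * (1 - h) `^ (p * g / (p - 1))))
    `^ (p - 1) < 1 - g * h.
Proof.
move=> p1 g0 g1 h0 h1.
set q := 1 - h; have q0 : 0 < q by rewrite /q; lra.
set y := 1 - g * h; have y0 : 0 < y by rewrite /y; nra.
have zy : q `^ g <= y.
  have := @powR_le_tangent g q g0 g1.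
  by rewrite (_ : 1 + g * (q - 1) = y) ?(ltW y0) ?(ltW q0) => [/(_ isT
    isT)//|]; rewrite /q /y; ring.
have y1 : y < 1 by rewrite /y; nra.
have m0 : 0 < p - 1 by lra.
(* The exponent p g / (p - 1) splits as g + g / (p - 1). The factor q ^ g is absorbed by the
   denominator, and the remaining k satisfies k ^ (p - 1) = q ^ g <= 1 - g h. *)
set k := q `^ (g / (p - 1)).
have kE : k = (q `^ g) `^ (p - 1)^-1 by rewrite -powRrM.
have k0 : 0 < k by exact: powR_gt0.
have z0 : 0 < q `^ g by exact: powR_gt0.
have ky : k <= y `^ (p - 1)^-1.
  by rewrite kE; apply: ge0_ler_powR;
    rewrite ?nnegrE ?invr_ge0 ?(ltW m0) ?(ltW y0) ?(ltW z0).
have k1 : k < 1.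
  apply: le_lt_trans ky _;
    rewrite powR_expR// -[ltRHS]expR0 ltr_expR pmulr_rlt0 ?invr_gt0//.
  by rewrite ln_lt0// y0.
have -> : q `^ (p * g / (p - 1)) = q `^ g * k.
  rewrite /k -powRD; last by rewrite (gt_eqF q0) implybT.
  by congr (_ `^ _); field; rewrite gt_eqF.
set z := q `^ g in z0 zy *.
have D : z < 1 - g * h * (z * k).
  have : g * h * (z * k) < g * h by rewrite gtr_pMr ?mulr_gt0//; nra.
  have H1 : z <= 1 - g * h by [].
  lra.
have W : z * k / (1 - g * h * (z * k)) < k.
  by rewrite ltr_pdivrMr ?(lt_trans z0 D)// [ltLHS]mulrC ltr_pM2l.
apply: lt_le_trans (_ : k `^ (p - 1) <= _).
  by apply: gt0_ltr_powR;
    rewrite ?nnegrE ?(ltW k0)// divr_ge0 ?mulr_ge0 ?(ltW z0) ?(ltW k0)// ltW//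
    (lt_trans z0 D).
by rewrite kE -powRrM mulVf ?gt_eqF// powRr1 ?(ltW z0).
Qed.

Lemma weight_ineq_above_large p g h : 1 < p -> 1 <= g -> 0 < h ->
  1 + g * h < (1 + h) `^ (p - 1 + p * g) * (1 + (1 + g) * h) `^ (1 - p).
Proof.
move=> p1 g1 h0.
have H1 : 1 + (1 + g) * h < (1 + h) `^ (1 + g).
  have := @powR_gt_tangent (1 + g) (1 + h).
  by rewrite addrAC subrr add0r; apply; [lra|lra|apply/eqP; lra].
have H2 : 1 + g * h <= (1 + h) `^ g.
  by have := @powR_ge_tangent g (1 + h); rewrite addrAC subrr add0r; apply; lra.
have X0 : 0 < 1 + (1 + g) * h by nra.
have h1 : 0 < 1 + h by lra.
apply: le_lt_trans H2 _.
rewrite -[1 - p]opprB powRN ltr_pdivlMr ?powR_gt0//.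
(* One part of the exponent dominates 1 + g h through [H2], the other beats the denominator through
   [H1]. *)
rewrite (_ : p - 1 + p * g = g + (1 + g) * (p - 1)); last ring.
rewrite (@powRD _ (1 + h)) ?(gt_eqF h1) ?implybT// ltr_pM2l ?powR_gt0// powRrM.
by apply: gt0_ltr_powR; rewrite ?nnegrE ?powR_ge0 ?(ltW X0)//; lra.
Qed.

End power_inequalities.

(** * Edge weights in the three ranges of the exponent *)

Section hardy_weights.
Set Implicit Arguments.
Unset Strict Implicit.
Context {R : realType}.
Implicit Types a b d g h m p x y N X Y : R.

(** Extracts the power of N = n from an edge weight. What remains depends on h = 1/n only, which is
    the form of the scalar inequalities. *)
Lemma powR_scale a m b N X Y : 0 < N -> 0 <= b -> 0 < X -> 0 <= Y ->
  (N * Y) `^ a * (b / (N * X)) `^ m =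
  b `^ m * N `^ (a - m) * (Y `^ a * X `^ (- m)).
Proof.
move=> N0 b0 X0 Y0; have NX : 0 < N * X by rewrite mulr_gt0.
rewrite powRM ?(ltW N0)// powRM ?invr_ge0 ?(ltW NX)//.
rewrite -(@powR_inv1 _ (N * X)) ?(ltW NX)// -powRrM mulN1r powRM ?(ltW N0)
  ?(ltW X0)//.
by rewrite (@powRD _ N) ?(gt_eqF N0) ?implybT//; ring.
Qed.

Lemma powR_succ_scale a p b N : 0 < N -> 0 < b ->
  b `^ p * N `^ (a - p) = b `^ (p - 1) * N `^ (a - (p - 1)) * (b * N^-1).
Proof.
move=> N0 b0; rewrite -(@powR_inv1 _ N) ?(ltW N0)//.
rewrite -{3}(@powRr1 _ b) ?(ltW b0)//.
rewrite mulrACA -!powRD ?(gt_eqF N0) ?(gt_eqF b0) ?implybT//.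
by congr (_ `^ _ * _ `^ _); ring.
Qed.

Lemma picone_edge_weighted p a d e N x y : 1 < p -> 0 < d -> d < 1 -> 0 <= N ->
  d / (1 - d) = e ->
  N `^ a * d `^ (p - 1) * `|x| `^ p - N `^ a * e `^ (p - 1) * `|y| `^ p <=
  `|x - y| `^ p * N `^ a.
Proof.
move=> p1 d0 d1 N0 <-; have := picone_edge x y p1 d0 d1.
rewrite -lerBlDr => /(ler_wpM2l (powR_ge0 N a)).
by rewrite mulrBr !mulrA [leRHS]mulrC.
Qed.

(** For the edge from n - 1 to n, P n is the coefficient at n and - Q n the one at n - 1; either may
    be negative. The first clause handles the edge from 0 to 1, where the sequence vanishes at 0. *)
Definition hardy_edge_weights p a (c : R) (P Q : nat -> R) :=
  [/\ P 1%N <= 1,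
      forall n x y, (1 < n)%N ->
        P n * `|x| `^ p - Q n * `|y| `^ p <= `|x - y| `^ p * n%:R `^ a &
      forall n, (0 < n)%N -> c * n%:R `^ (a - p) < P n - Q n.+1].

Lemma natr_pred_gt0 n : (1 < n)%N -> 0 < n%:R - 1 :> R.
Proof. by move=> n1; rewrite subr_gt0 (_ : 1 = 1%:R)// ltr_nat. Qed.

Lemma edge_weights_below p a (b := (p - 1 - a) / p) :
  1 < p -> 0 <= a -> a < p - 1 ->
  hardy_edge_weights p a (b `^ p)
    (fun n => n%:R `^ a * (b / (n%:R - 1 + b)) `^ (p - 1))
    (fun n => n%:R `^ a * (b / (n%:R - 1)) `^ (p - 1)).
Proof.
move=> p1 a0 ap.
have b0 : 0 < b by rewrite divr_gt0//; lra.
have pb : p * b = p - 1 - a by rewrite mulrC divfK//; apply/eqP; lra.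
have b1 : b < 1 by nra.
split.
- by rewrite subrr add0r divff ?gt_eqF// !powR1 mulr1.
- move=> n x y n1; have N1 := natr_pred_gt0 n1.
  have D0 : 0 < n%:R - 1 + b by rewrite addr_gt0.
  apply: picone_edge_weighted => //.
  + exact: divr_gt0.
  + by rewrite ltr_pdivrMr// mul1r ltrDr.
  + by field; rewrite !gt_eqF.
- move=> n n0; have N0 : 0 < n%:R :> R by rewrite ltr0n.
  have h0 : 0 < n%:R^-1 :> R by rewrite invr_gt0.
  have h1 : n%:R^-1 <= 1 :> R by rewrite invf_le1// ler1n.
  have X0 : 0 < 1 - (1 - b) * n%:R^-1 by nra.
  have h'0 : 0 <= 1 + n%:R^-1 :> R by rewrite addr_ge0// ltW.
  have E1 := powR_scale a (p - 1) N0 (ltW b0) X0 ler01.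
  have E2 := powR_scale a (p - 1) N0 (ltW b0) ltr01 h'0.
  rewrite mulr1 powR1 mul1r in E1; rewrite mulr1 powR1 mulr1 in E2.
  have -> : n%:R - 1 + b = n%:R * (1 - (1 - b) * n%:R^-1).
    by field; rewrite gt_eqF.
  have F : n.+1%:R = n%:R * (1 + n%:R^-1) :> R.
    by rewrite -natr1; field; rewrite gt_eqF.
  rewrite powR_succ_scale// -{2}natr1 addrK F E1 E2 -mulrBr ltr_pM2l.
    by rewrite ltrBrDl opprB weight_ineq_below.
  by rewrite mulr_gt0// powR_gt0.
Qed.

(** The edge inequality is used with its endpoints exchanged, hence the minus signs. The power of 1
    - 1/n in d_n is chosen so that n ^ a d_n ^ (p - 1) collapses to g ^ (p - 1) (n - 1) ^ (p g),
    whose shift to n + 1 factors out cleanly at the vertex n. *)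
Lemma edge_weights_above_small p a (g := (a - (p - 1)) / p) :
  1 < p -> p - 1 < a -> g <= 1 ->
  hardy_edge_weights p a (g `^ p)
    (fun n => if n == 1%N then 1 else
       let z := (1 - n%:R^-1) `^ (p * g / (p - 1)) in
       - (n%:R `^ a * (g / n%:R * (z / (1 - g * n%:R^-1 * z))) `^ (p - 1)))
    (fun n => - (g `^ (p - 1) * (n%:R - 1) `^ (p * g))).
Proof.
move=> p1 ap g1.
have g0 : 0 < g by rewrite divr_gt0//; lra.
have pg : p * g = a - (p - 1) by rewrite mulrC divfK//; apply/eqP; lra.
clearbody g.
have H n : (1 < n)%N -> let h := n%:R^-1 : R in
    let z := (1 - h) `^ (p * g / (p - 1)) in
    [/\ 0 < h, h < 1, 0 < z & g * h * z < 1].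
  move=> n1 h z; have n0 : (0 < n%:R :> R) by rewrite ltr0n ltnW.
  have h0 : 0 < h by rewrite invr_gt0.
  have h1 : h < 1 by rewrite invf_lt1// ltr1n.
  have z0 : 0 < z by rewrite powR_gt0// subr_gt0.
  split => //; have z1 : z <= 1.
    rewrite /z powR_expR ?subr_gt0// -[leRHS]expR0 ler_expR pmulr_rle0.
      by rewrite ln_le0//; lra.
    have p0 : 0 < p by lra.
    by apply: divr_gt0; rewrite ?subr_gt0//; apply: mulr_gt0.
  apply: (@le_lt_trans _ _ (g * h)); first by rewrite ler_piMr// ltW// mulr_gt0.
  by apply: le_lt_trans h1; rewrite ger_pMl.
split.
- by [].
- move=> n x y n1; rewrite gtn_eqF//=; have [h0 h1 z0 d1] := H n n1.
  have n0 : (0 < n%:R :> R) by rewrite ltr0n ltnW.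
  move: h0 h1 z0 d1; set h := n%:R^-1; set z := powR _ _ => h0 h1 z0 d1.
  have d0 : 0 < g * h * z by apply: mulr_gt0 => //; apply: mulr_gt0.
  have := @picone_edge_weighted p a (g * h * z) _ n%:R y x p1 d0 d1 (ltW n0)
    erefl.
  rewrite distrC; apply: le_trans.
  rewrite !mulNr opprK addrC -mulrA lerB//.
    rewrite ler_wpM2r ?powR_ge0// le_eqVlt; apply/orP; left; apply/eqP.
    have -> : (g * h * z) `^ (p - 1) = g `^ (p - 1) * (h `^ (p - 1) * z `^ (p -
      1)).
      by rewrite -(mulrA g h z) !powRM ?mulr_ge0 ?(ltW g0) ?(ltW h0) ?(ltW z0).
    have -> : n%:R - 1 = n%:R * (1 - h) by rewrite mulrBr mulr1 divff ?gt_eqF.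
    have -> : (n%:R * (1 - h)) `^ (p * g) = n%:R `^ (p * g) * z `^ (p - 1).
      rewrite powRM ?(ltW n0) ?subr_ge0 ?(ltW h1)//; congr (_ * _).
      by rewrite -powRrM divfK// gt_eqF// subr_gt0.
    have -> : n%:R `^ (p * g) = n%:R `^ a * h `^ (p - 1).
      rewrite pg (@powRB _ n%:R) ?(gt_eqF n0) ?implybT//; congr (_ * _).
      by rewrite /h -(@powR_inv1 _ n%:R) ?(ltW n0)// -powRrM mulN1r powRN.
    by ring.
  by rewrite !mulrA.
- move=> n n0; have N0 : 0 < n%:R :> R by rewrite ltr0n.
  rewrite opprK -[n.+1%:R]natr1 addrK.
  (* At n = 1 the claim reads g ^ p < 1 + g ^ (p - 1), which follows from g <= 1. *)
  have [->|n1'] := eqVneq n 1%N.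
    rewrite !powR1 !mulr1.
    have : g `^ p <= 1.
      rewrite powR_expR// -[leRHS]expR0 ler_expR pmulr_rle0 ?ln_le0//; lra.
    have : 0 < g `^ (p - 1) by exact: powR_gt0.
    lra.
  have n1 : (1 < n)%N by rewrite ltn_neqAle eq_sym n1'.
  have [h0 h1 z0 d1] := H n n1.
  have := weight_ineq_above_small p1 g0 g1 h0 h1.
  rewrite powR_succ_scale//=.
  move: h0 h1 z0 d1; set h := n%:R^-1; set z := powR _ _ => h0 h1 z0 d1.
  set Z := z / _ => Zlt.
  have Z0 : 0 < Z by rewrite divr_gt0// subr_gt0.
  have := @powR_scale a (p - 1) g n%:R 1 1 N0 (ltW g0) ltr01 ler01.
  rewrite !powR1 !mulr1 -/h => E.
  rewrite powRM ?(ltW Z0)// ?mulr_ge0 ?(ltW g0) ?(ltW h0)//.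
  rewrite (mulrA (n%:R `^ a)) E pg.
  rewrite [ltRHS]addrC -[X in _ < X - _]mulr1 -mulrBr ltr_pM2l; last first.
    by rewrite mulr_gt0// powR_gt0.
  by rewrite ltrBrDr addrC -ltrBrDr.
Qed.

Lemma edge_weights_above_large p a (g := (a - (p - 1)) / p) :
  1 < p -> 1 <= g ->
  hardy_edge_weights p a (g `^ p)
    (fun n => if n == 1%N then 1 else - (n%:R `^ a * (g / n%:R) `^ (p - 1)))
    (fun n => - (n%:R `^ a * (g / (n%:R + g)) `^ (p - 1))).
Proof.
move=> p1 g1; have g0 : 0 < g by lra.
have pg : p * g = a - (p - 1) by rewrite mulrC divfK//; apply/eqP; lra.
clearbody g.
split => //.
- move=> n x y n1; rewrite gtn_eqF//.
  have n0 : (0 < n%:R :> R) by rewrite ltr0n ltnW.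
  have D0 : 0 < n%:R + g by rewrite addr_gt0.
  rewrite distrC !mulNr opprK addrC; apply: picone_edge_weighted => //.
  + exact: divr_gt0.
  + by rewrite ltr_pdivrMr// mul1r ltrDr.
  + by field; rewrite !gt_eqF.
- move=> n n0; have N0 : 0 < n%:R :> R by rewrite ltr0n.
  have h0 : 0 < n%:R^-1 :> R by rewrite invr_gt0.
  have h'0 : 0 <= 1 + n%:R^-1 :> R by rewrite addr_ge0// ltW.
  have X0 : 0 < 1 + (1 + g) * n%:R^-1 by nra.
  set P := (X in _ < X - _).
  (* The exceptional value 1 at n = 1 exceeds the generic nonpositive formula, so the generic
     formula can serve as a lower bound at every n. *)
  have PP : - (n%:R `^ a * (g / n%:R) `^ (p - 1)) <= P.
    rewrite /P; case: ifPn => // _; apply: (@le_trans _ _ 0) => //.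
    by rewrite oppr_le0 mulr_ge0// powR_ge0.
  apply: lt_le_trans (lerB PP (lexx _)); rewrite opprK.
  have E1 := powR_scale a (p - 1) N0 (ltW g0) ltr01 ler01.
  have E2 := powR_scale a (p - 1) N0 (ltW g0) X0 h'0.
  rewrite mulr1 !powR1 !mulr1 in E1.
  have F : n.+1%:R = n%:R * (1 + n%:R^-1) :> R.
    by rewrite -natr1; field; rewrite gt_eqF.
  have G : n.+1%:R + g = n%:R * (1 + (1 + g) * n%:R^-1) :> R.
    by rewrite -natr1; field; rewrite gt_eqF.
  rewrite powR_succ_scale// G F E1 E2 [ltRHS]addrC -[X in _ < _ - X]mulr1
    -mulrBr ltr_pM2l.
    rewrite ltrBrDl opprB (_ : a = p - 1 + p * g) ?weight_ineq_above_large//.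
    by rewrite pg; ring.
  by rewrite mulr_gt0// powR_gt0.
Qed.

Lemma edge_weights_exist p a : 1 < p -> 0 <= a -> a != p - 1 ->
  exists P Q, hardy_edge_weights p a (`|(p - 1 - a) / p| `^ p) P Q.
Proof.
move=> p1 a0; have p0 : 0 < p by lra.
rewrite neq_lt => /orP[ap|ap].
  rewrite ger0_norm; last by rewrite divr_ge0//; lra.
  by do 2 eexists; exact: edge_weights_below.
rewrite -normrN -mulNr opprB ger0_norm; last by rewrite divr_ge0//; lra.
have [g1|/ltW g1] := leP ((a - (p - 1)) / p) 1.
  by do 2 eexists; exact: edge_weights_above_small.
by do 2 eexists; exact: edge_weights_above_large.
Qed.

End hardy_weights.

(** * Reduction to finite sums, summation over edges, and elementary estimates for the test
    sequences *)

Section finite_support.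
Set Implicit Arguments.
Unset Strict Implicit.
Context {R : realType}.
Implicit Types (u v : nat -> R) (p a : R) (N n : nat).

Lemma eseries_finsupp (f : nat -> R) N : (forall n, (N < n)%N -> f n = 0) ->
  (\sum_(1 <= n <oo) (f n)%:E)%E = (\sum_(1 <= n < N.+1) f n)%:E.
Proof.
move=> f0; apply: cvg_lim => //; apply: cvg_near_cst.
exists N.+1 => //= n Nn.
rewrite (@big_cat_nat _ _ _ N.+1)//= -sumEFin [X in (_ + X)%E]big1_seq ?adde0//.
by move=> i /andP[_]; rewrite mem_index_iota => /andP[/f0 ->].
Qed.

Lemma H10_supp (x : H10 R) : H10_val x 0%N = 0 /\
  exists N, forall n, (N <= n)%N -> H10_val x n = 0.
Proof. by case: x => u uP /=; move: (uP); rewrite inE. Qed.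

Lemma H10_mk u N : u 0%N = 0 -> (forall n, (N <= n)%N -> u n = 0) ->
  exists x : H10 R, H10_val x = u.
Proof.
move=> u0 uN; have uP : u \in @finsupp0 R by rewrite inE; split => //; exists N.
by exists (MkH10 uP).
Qed.

Lemma wsumE p (w : nat -> R) u N : p != 0 -> (forall n, (N <= n)%N -> u n = 0)
  ->
  wsum p w u = (\sum_(1 <= n < N.+1) `|u n| `^ p * w n)%:E.
Proof.
move=> p0 uN; apply: eseries_finsupp => n /ltnW Nn.
by rewrite uN// normr0 powR0// mul0r.
Qed.

Lemma energyE p a u N : p != 0 -> (forall n, (N <= n)%N -> u n = 0) ->
  energy a p u = (\sum_(1 <= n < N.+1) `|u n - u n.-1| `^ p * n%:R `^ a)%:E.
Proof.
move=> p0 uN; apply: eseries_finsupp => -[//|n] Nn /=.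
by rewrite !uN// ?subrr ?normr0 ?powR0 ?mul0r// ltnW.
Qed.

(* Summing the edge inequalities, each vertex n collects P n from the edge
   ending at n and - Q n.+1 from the edge starting at n. *)
Lemma energy_ge_edge_weights p a (c : R) P Q u N : p != 0 ->
  hardy_edge_weights p a c P Q -> u 0%N = 0 -> u N = 0 ->
  \sum_(1 <= n < N.+1) `|u n| `^ p * (P n - Q n.+1) <=
  \sum_(1 <= n < N.+1) `|u n - u n.-1| `^ p * n%:R `^ a.
Proof.
move=> p0 [P1 PQ _] u0 uN.
(* The term in Q M.+1 restores what the edge from M to M + 1, not yet summed, would subtract. It
   vanishes at M = N because u N = 0. *)
suff H M : \sum_(1 <= n < M.+1) `|u n| `^ p * (P n - Q n.+1)
             + Q M.+1 * `|u M| `^ p <=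
           \sum_(1 <= n < M.+1) `|u n - u n.-1| `^ p * n%:R `^ a.
  by have := H N; rewrite uN normr0 powR0// mulr0 addr0.
elim: M => [|M IH]; first by rewrite !big_nil u0 normr0 powR0// mulr0 addr0.
rewrite !(big_nat_recr M.+1)//=.
have edge : P M.+1 * `|u M.+1| `^ p - Q M.+1 * `|u M| `^ p <=
    `|u M.+1 - u M| `^ p * M.+1%:R `^ a.
  case: M {IH} => [|M]; last exact: PQ.
  rewrite u0 subr0 normr0 powR0// mulr0 subr0 powR1 mulr1 -[leRHS]mul1r.
  by rewrite ler_wpM2r// powR_ge0.
lra.
Qed.

(** Controls the increments of n ^ b with the exact factor |b|, so that the test sequences yield the
    constant |b| ^ p. *)
Lemma powR_1D_dist b h : b <= 1 -> 0 <= h -> `|(1 + h) `^ b - 1| <= `|b| * h :>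
  R.
Proof.
move=> b1 h0; have h1 : 0 < 1 + h by lra.
have lnh0 : 0 <= ln (1 + h) by apply: ln_ge0; lra.
have [b0|b0] := leP b 0.
  have lnh : ln (1 + h) <= h by apply: le_ln1Dx; lra.
  rewrite powR_expR//; have e1 : expR (b * ln (1 + h)) <= 1.
    by rewrite -[leRHS]expR0 ler_expR; nra.
  rewrite ler0_norm ?subr_le0// ler0_norm//.
  have := @expR_ge1Dx R (b * ln (1 + h)).
  have : b * h <= b * ln (1 + h) by rewrite ler_wnM2l.
  lra.
have E : 1 + b * (1 + h - 1) = 1 + b * h by ring.
have := @powR_le_tangent R b (1 + h) b0 b1; rewrite E => /(_ _ (ltW h1)) H.
have {}H : (1 + h) `^ b <= 1 + b * h by apply: H; nra.
have e1 : 1 <= (1 + h) `^ b by rewrite powR_expR// -[leLHS]expR0 ler_expR; nra.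
by rewrite ger0_norm ?subr_ge0// gtr0_norm//; lra.
Qed.

(** Chord bound on [1, 2]. Raising the exponent to a + 2 makes the power convex for every a >= 0. *)
Lemma powR_1D_le a h : 0 <= a -> 0 < h -> h <= 1 ->
  (1 + h) `^ a <= 1 + 2 `^ (a + 2) * h :> R.
Proof.
move=> a0 h0 h1.
have H : (1 + h) `^ a <= (1 + h) `^ (a + 2) by apply: ler_powR; lra.
apply: (le_trans H); have K : 0 < 2 `^ (a + 2) :> R by exact: powR_gt0.
move: h1; rewrite le_eqVlt => /orP[/eqP ->|h1].
  by rewrite (_ : 1 + 1 = 2)//; lra.
have := @powR_convex R (a + 2) 2 1 h; rewrite powR1 !mulr1.
rewrite (_ : h * 2 + (1 - h) = 1 + h); last ring.
move=> T; apply: (@le_trans _ _ (h * 2 `^ (a + 2) + (1 - h))); last lra.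
by apply: T => //; lra.
Qed.

Lemma sum_inv_sqr_le N : \sum_(1 <= k < N.+1) (k%:R ^- 2 : R) <= 2.
Proof.
case: N => [|N]; first by rewrite big_nil.
suff H : \sum_(1 <= k < N.+2) (k%:R ^- 2 : R) <= 2 - N.+1%:R^-1.
  by apply: (le_trans H); rewrite gerBl.
elim: N => [|N IH]; first by rewrite big_nat1 expr1n invr1; lra.
rewrite big_nat_recr//=; apply: le_trans (lerD IH (lexx _)) _.
have : 0 < N.+1%:R :> R by [].
rewrite -(natr1 N.+1); set x := N.+1%:R => x0.
have x1 : 0 < x + 1 by rewrite addr_gt0.
clearbody x; suff : (x + 1) ^- 2 <= x^-1 - (x + 1)^-1 by lra.
have -> : x^-1 - (x + 1)^-1 = (x * (x + 1))^-1.
  by field; rewrite !gt_eqF.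
by rewrite lef_pV2 ?posrE; nra.
Qed.

Lemma harmonic_unbounded (M : R) :
  exists2 N, (0 < N)%N & M < \sum_(1 <= n < N.+1) (n%:R^-1 : R).
Proof.
apply: contrapT => H; apply: (@dvg_harmonic R).
apply: nondecreasing_is_cvgn.
  by apply/nondecreasing_seqP => n; rewrite /series/= big_nat_recr//= lerDl.
exists M => _ [n _ <-]; rewrite leNgt; apply/negP => Mn; apply: H.
exists n.+1 => //; apply: (lt_trans Mn).
rewrite /series/= big_add1/= big_nat_recr//= ltrDl.
by rewrite invr_gt0.
Qed.

End finite_support.

(** * Upper bound on the sharp constant by test sequences *)

Section hardy_const_bound.
Set Implicit Arguments.
Unset Strict Implicit.
Context {R : realType}.
Implicit Types (p a b : R) (N n : nat).

(* The extremal profile n ^ b, cut off linearly between N and 2N; truncated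
   subtraction makes it vanish beyond 2N. *)
Definition hardy_test b (N n : nat) : R :=
  if n == 0%N then 0 else
  if (n <= N)%N then n%:R `^ b else N%:R `^ b * ((2 * N - n)%N%:R / N%:R).

Lemma hardy_test_ge b N n : (2 * N <= n)%N -> hardy_test b N n = 0.
Proof.
move=> Nn; rewrite /hardy_test; case: eqVneq => [//|n0].
have [nN|_] := leqP n N; last first.
  by move: Nn; rewrite -subn_eq0 => /eqP ->; rewrite mul0r mulr0.
move: (leq_trans Nn nN); rewrite mul2n -addnn -[leqRHS]addn0 leq_add2l leqn0.
by move=> /eqP N0; move: nN n0; rewrite N0 leqn0 => /eqP ->.
Qed.

(** The exponents add up to b p + a - p = -1, so the Hardy sum up to N is exactly harmonic. *)
Lemma hardy_test_vertex p a b N n : b * p = p - 1 - a -> (0 < n <= N)%N ->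
  `|hardy_test b N n| `^ p * n%:R `^ (a - p) = n%:R^-1.
Proof.
move=> bp /andP[n0 nN]; have N0 : 0 < n%:R :> R by rewrite ltr0n.
rewrite /hardy_test gtn_eqF// nN ger0_norm ?powR_ge0// -powRrM.
rewrite -powRD ?(gt_eqF N0) ?implybT// bp.
by rewrite -(@powR_inv1 _ n%:R) ?(ltW N0)//; congr (_ `^ _); lra.
Qed.

(** Factoring n ^ b out of the increment leaves |b| ^ p / n times (1 + 1/n) ^ a; the excess of the
    latter over 1 gives the summable correction. *)
Lemma hardy_test_edge_inner p a b N n :
  1 < p -> 0 <= a -> b * p = p - 1 - a -> (0 < n < N)%N ->
  `|hardy_test b N n.+1 - hardy_test b N n| `^ p * n.+1%:R `^ a <=
  `|b| `^ p * (n%:R^-1 + 2 `^ (a + 2) * n%:R ^- 2).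
Proof.
move=> p1 a0 bp /andP[n0 nN]; have N0 : 0 < n%:R :> R by rewrite ltr0n.
have h0 : 0 < n%:R^-1 :> R by rewrite invr_gt0.
have h1 : n%:R^-1 <= 1 :> R by rewrite invf_le1// ler1n.
rewrite /hardy_test (gtn_eqF n0) nN (ltnW nN) /=.
have -> : n.+1%:R = n%:R * (1 + n%:R^-1) :> R.
  by rewrite -natr1; field; rewrite gt_eqF.
have h'0 : 0 <= 1 + n%:R^-1 :> R by lra.
rewrite !powRM ?(ltW N0)// -{2}(mulr1 (n%:R `^ b)) -mulrBr normrM.
rewrite (ger0_norm (powR_ge0 _ _)) powRM ?powR_ge0// -powRrM bp.
have b1 : b <= 1 by nra.
have H : `|(1 + n%:R^-1) `^ b - 1| `^ p <= `|b| `^ p * n%:R^-1 `^ p :> R.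
  rewrite -powRM ?(ltW h0)//; apply: ge0_ler_powR;
    rewrite ?nnegrE ?mulr_ge0 ?(ltW h0)//; first lra.
  exact: powR_1D_dist (ltW h0).
have E : n%:R `^ (p - 1 - a) * (n%:R^-1 `^ p) * n%:R `^ a = n%:R^-1 :> R.
  rewrite -(@powR_inv1 _ n%:R) ?(ltW N0)// -powRrM -!powRD ?(gt_eqF N0)
    ?implybT//.
  by congr (_ `^ _); lra.
have H2 := powR_1D_le a0 h0 h1.
set d := `|_ - 1| `^ p in H *; set N1 := _ `^ (p - 1 - a) in E *.
apply: (@le_trans _ _ (N1 * (`|b| `^ p * n%:R^-1 `^ p) * (n%:R `^ a * (1 +
  n%:R^-1) `^ a))).
  by rewrite ler_wpM2r ?mulr_ge0 ?powR_ge0// ler_wpM2l// powR_ge0.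
have -> : N1 * (`|b| `^ p * n%:R^-1 `^ p) * (n%:R `^ a * (1 + n%:R^-1) `^ a) =
  `|b| `^ p * (N1 * n%:R^-1 `^ p * n%:R `^ a * (1 + n%:R^-1) `^ a) by ring.
rewrite E ler_wpM2l ?powR_ge0//.
apply: le_trans (ler_wpM2l (ltW h0) H2) _.
by rewrite le_eqVlt; apply/orP; left; apply/eqP; field; rewrite gt_eqF.
Qed.

(** Each of the N cut-off steps has size N ^ (b - 1), and n + 1 <= 2N. The cut-off thus costs at
    most 2 ^ a in total, whatever N is. *)
Lemma hardy_test_edge_outer p a b N n :
  1 < p -> 0 <= a -> b * p = p - 1 - a -> (0 < N)%N -> (N <= n < 2 * N)%N ->
  `|hardy_test b N n.+1 - hardy_test b N n| `^ p * n.+1%:R `^ a <= 2 `^ a /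
    N%:R.
Proof.
move=> p1 a0 bp N0 /andP[Nn n2]; have N0' : 0 < N%:R :> R by rewrite ltr0n.
have n0 : (0 < n)%N by exact: leq_trans Nn.
have -> : hardy_test b N n = N%:R `^ b * ((2 * N - n)%N%:R / N%:R).
  rewrite /hardy_test (gtn_eqF n0); case: ifP => // nN.
  have -> : n = N by apply/eqP; rewrite eqn_leq nN.
  by rewrite mul2n -addnn addnK divff ?gt_eqF// mulr1.
rewrite /hardy_test/= ltnNge Nn/= -mulrBr -mulrBl.
have -> : (2 * N - n)%N = (2 * N - n.+1).+1 by rewrite subnSK.
rewrite -[(2 * N - n.+1).+1%:R]natr1 opprD addrA subrr add0r mulN1r.
rewrite normrM normrN !ger0_norm ?powR_ge0// ?invr_ge0 ?(ltW N0')//.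
rewrite powRM ?powR_ge0 ?invr_ge0 ?(ltW N0')// -powRrM bp.
have nN2 : n.+1%:R <= 2 * N%:R :> R by rewrite -natrM ler_nat.
have H : n.+1%:R `^ a <= 2 `^ a * N%:R `^ a :> R.
  by rewrite -powRM ?(ltW N0')//; apply: ge0_ler_powR;
    rewrite ?nnegrE ?mulr_ge0 ?(ltW N0').
have E : N%:R `^ (p - 1 - a) * (N%:R^-1 `^ p) * N%:R `^ a = N%:R^-1 :> R.
  rewrite -(@powR_inv1 _ N%:R) ?(ltW N0')// -powRrM -!powRD ?(gt_eqF N0')
    ?implybT//.
  by congr (_ `^ _); lra.
have -> : 2 `^ a / N%:R = N%:R `^ (p - 1 - a) * N%:R^-1 `^ p * (2 `^ a * N%:R
  `^ a).
  by rewrite mulrCA E.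
by rewrite ler_wpM2l ?mulr_ge0 ?powR_ge0.
Qed.

(** An admissible C > c = |b| ^ p would give C H <= c H + K for every harmonic sum H, with K
    independent of N, against the divergence of H. *)
Lemma hardy_const_le p a b : 1 < p -> 0 <= a -> b * p = p - 1 - a ->
  hardy_const a p <= `|b| `^ p.
Proof.
move=> p1 a0 bp; have p0 : p != 0 by apply/eqP; lra.
apply: ge_sup.
  (* Bounding the supremum requires a nonempty set; 0 is an admissible constant. *)
  exists 0 => u; rewrite mul0e; apply: nneseries_ge0 => n _ _.
  by rewrite lee_fin mulr_ge0// powR_ge0.
move=> C /= HC; rewrite leNgt; apply/negP => bC.
set c := `|b| `^ p in bC; have c0 : 0 <= c by exact: powR_ge0.
(* The three terms bound the first edge, the summed n ^ -2 corrections, and the cut-off. *)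
pose K := 1 + c * (2 `^ (a + 2) * 2) + 2 `^ a.
have [N N0 HN] := @harmonic_unbounded R (K / (C - c)).
have [u uE] := @H10_mk R (hardy_test b N) (2 * N) erefl (@hardy_test_ge b N).
have := HC u; rewrite uE.
rewrite /hardy_sum (wsumE _ p0 (@hardy_test_ge b N)) (energyE _ p0
  (@hardy_test_ge b N)).
rewrite -EFinM lee_fin leNgt => /negP; apply.
have N0' : 0 < N%:R :> R by rewrite ltr0n.
have N2 : (N.+1 <= (2 * N).+1)%N by rewrite ltnS leq_pmull.
set H := \sum_(1 <= n < N.+1) (n%:R^-1 : R) in HN.
have S1 : H <= \sum_(1 <= n < (2 * N).+1) `|hardy_test b N n| `^ p * n%:R `^ (a
  - p).
  rewrite [leRHS](@big_cat_nat _ _ _ N.+1)//=.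
  rewrite /H (eq_big_nat _ _ (F2 := fun n => `|hardy_test b N n| `^ p * n%:R `^
    (a - p))).
    by rewrite lerDl sumr_ge0// => i _; rewrite mulr_ge0// powR_ge0.
  by move=> i iN; rewrite (hardy_test_vertex bp).
have S2 : \sum_(1 <= n < (2 * N).+1)
    `|hardy_test b N n - hardy_test b N n.-1| `^ p * n%:R `^ a <= K + c * H.
  rewrite (@big_cat_nat _ _ _ N.+1)//=.
  have outer : \sum_(N.+1 <= i < (2 * N).+1)
      `|hardy_test b N i - hardy_test b N i.-1| `^ p * i%:R `^ a <= 2 `^ a.
    rewrite big_add1/=.
    apply: (@le_trans _ _ (\sum_(N <= i < 2 * N) 2 `^ a / N%:R)).
      by apply: ler_sum_nat => i iN; exact: hardy_test_edge_outer.
    rewrite sumr_const_nat mul2n -addnn addnK -[X in X <= _]mulr_natr.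
    by rewrite divfK// gt_eqF.
  have inner : \sum_(1 <= i < N.+1)
      `|hardy_test b N i - hardy_test b N i.-1| `^ p * i%:R `^ a <=
      1 + c * (H + 2 `^ (a + 2) * 2).
    rewrite big_ltn// big_add1/=.
    rewrite {1 2}/hardy_test/= N0 subr0 !powR1 normr1 powR1 mulr1 lerD2l.
    apply: (@le_trans _ _ (\sum_(1 <= n < N)
        c * (n%:R^-1 + 2 `^ (a + 2) * n%:R ^- 2))).
      by apply: ler_sum_nat => i iN; exact: hardy_test_edge_inner.
    rewrite -mulr_sumr ler_wpM2l// big_split/= -mulr_sumr lerD//.
      by rewrite /H big_nat_recr//= lerDl invr_ge0.
    rewrite ler_wpM2l ?powR_ge0//.
    by case: (N) => [|M]; [rewrite big_nil|exact: sum_inv_sqr_le].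
  by rewrite /K; lra.
have Cc : 0 < C - c by rewrite subr_gt0.
move: HN; rewrite ltr_pdivrMr// => HN.
apply: (le_lt_trans S2).
have C0 : 0 < C by lra.
apply: lt_le_trans (ler_wpM2l (ltW C0) S1).
lra.
Qed.

End hardy_const_bound.

(** * The weighted l^p metric and the passage from an improved inequality to stability *)

Section weighted_lp_metric.
Set Implicit Arguments.
Unset Strict Implicit.
Context {R : realType}.
Implicit Types (p a : R) (W : nat -> R) (x y z : H10 R).

Definition weighted_norm p W x : R := fine (wsum p W x) `^ p^-1.

Lemma H10_bound2 x y : exists N, forall n, (N <= n)%N -> x n = 0 /\ y n = 0.
Proof.
have [_ [N xN]] := H10_supp x; have [_ [M yM]] := H10_supp y.
exists (maxn N M) => n; rewrite geq_max => /andP[Nn Mn].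
by rewrite xN ?yM.
Qed.

Lemma H10_oppE x n : (- x) n = - x n.
Proof. by []. Qed.

Lemma H10_addE x y n : (x + y) n = x n + y n.
Proof. by []. Qed.

Lemma weighted_norm_powR p W x : 1 < p -> (forall n, (0 < n)%N -> 0 < W n) ->
  (weighted_norm p W x `^ p)%:E = wsum p W x.
Proof.
move=> p1 W0; have p0 : p != 0 by apply/eqP; lra.
have [_ [N xN]] := H10_supp x.
rewrite /weighted_norm (wsumE _ p0 xN)/= -powRrM mulVf// powRr1//.
rewrite big_nat_cond sumr_ge0// => i /andP[/andP[i0 _] _].
by rewrite mulr_ge0 ?powR_ge0// ltW// W0.
Qed.

Lemma weighted_norm_ge0 p W x : 0 <= weighted_norm p W x.
Proof. exact: powR_ge0. Qed.

Lemma weighted_norm0 p W : 1 < p -> weighted_norm p W 0 = 0.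
Proof.
move=> p1; have p0 : p != 0 by apply/eqP; lra.
rewrite /weighted_norm (@wsumE _ p W (0 : H10 R) 0)//= big_nil.
by rewrite powR0// invr_eq0.
Qed.

Lemma weighted_norm_eq0 p W x : 1 < p -> (forall n, (0 < n)%N -> 0 < W n) ->
  weighted_norm p W x = 0 -> x = 0.
Proof.
move=> p1 W0 nx; have p0 : p != 0 by apply/eqP; lra.
have := weighted_norm_powR x p1 W0; rewrite nx powR0//.
have [x0 [N xN]] := H10_supp x.
rewrite (wsumE _ p0 xN) => -[/esym/eqP].
rewrite big_nat_cond psumr_eq0 => [/allP H|i /andP[/andP[i0 _] _]]; last first.
  by rewrite mulr_ge0 ?powR_ge0// ltW// W0.
apply: val_inj; apply/funext => n /=.
have [->//|n0] := posnP n.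
have [Nn|nN] := leqP N n; first by rewrite xN.
have nI : n \in index_iota 1 N.+1 by rewrite mem_index_iota n0 ltnS ltnW.
have := H n nI; rewrite n0 ltnS (ltnW nN)/= mulf_eq0 (gt_eqF (W0 n n0)) orbF.
by rewrite powR_eq0 normr_eq0 => /andP[/eqP].
Qed.

Lemma weighted_normN p W x : weighted_norm p W (- x) = weighted_norm p W x.
Proof.
have E : wsum p W (- x) = wsum p W x.
  by apply: eq_eseriesr => n _; rewrite H10_oppE normrN.
by rewrite /weighted_norm E.
Qed.

(** Minkowski's inequality. With A and B the norms of x and y, [powR_addr_le] is applied termwise at
    t = A / (A + B), for which the summed right-hand side is exactly (A + B) ^ p. Zero vectors are
    treated apart to keep 0 < t < 1. *)
Lemma ler_weighted_normD p W x y : 1 < p -> (forall n, (0 < n)%N -> 0 < W n) ->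
  weighted_norm p W (x + y) <= weighted_norm p W x + weighted_norm p W y.
Proof.
move=> p1 W0; have p0 : p != 0 by apply/eqP; lra.
have [->|x0] := eqVneq x 0; first by rewrite add0r lerDr weighted_norm_ge0.
have [->|y0] := eqVneq y 0; first by rewrite addr0 lerDl weighted_norm_ge0.
have pos z : z != 0 -> 0 < weighted_norm p W z.
  move=> z0; rewrite lt_neqAle weighted_norm_ge0 andbT eq_sym.
  by apply: contra z0 => /eqP /(weighted_norm_eq0 p1 W0) ->.
have := weighted_norm_powR x p1 W0; have := weighted_norm_powR y p1 W0.
have := weighted_norm_powR (x + y) p1 W0.
move: (pos _ x0) (pos _ y0) (weighted_norm_ge0 p W (x + y)).
set A := weighted_norm p W x; set B := weighted_norm p W y.
set S := weighted_norm p W (x + y) => A0 B0 S0.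
have [N xyN] := H10_bound2 x y.
rewrite (@wsumE _ _ _ x N)//; last by move=> n /xyN[].
rewrite (@wsumE _ _ _ y N)//; last by move=> n /xyN[].
rewrite (@wsumE _ _ _ (x + y) N)//; last first.
  by move=> n /xyN[xn yn]; rewrite H10_addE xn yn addr0.
move=> -[SE] [BE] [AE]; clearbody A B S.
have AB0 : 0 < A + B by rewrite addr_gt0.
have t0 : 0 < A / (A + B) by exact: divr_gt0.
have t1 : A / (A + B) < 1 by rewrite ltr_pdivrMr//; lra.
have tE : 1 - A / (A + B) = B / (A + B) by field; rewrite gt_eqF.
have H : S `^ p <= (A / (A + B)) `^ (1 - p) * A `^ p + (B / (A + B)) `^ (1 - p)
  * B `^ p.
  rewrite SE AE BE !mulr_sumr -big_split/=.
  apply: ler_sum_nat => n /andP[n0 _]; rewrite !mulrA -mulrDl.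
  rewrite ler_wpM2r ?(ltW (W0 _ n0))//.
  rewrite -tE; apply: le_trans (powR_addr_le p1 (normr_ge0 _) (normr_ge0 _) t0
    t1).
  by apply: ge0_ler_powR; rewrite ?nnegrE ?addr_ge0 ?ler_normD//; lra.
have E D : 0 < D -> (D / (A + B)) `^ (1 - p) * D `^ p = (A + B) `^ (p - 1) * D.
  move=> D0; rewrite powRM ?invr_ge0 ?(ltW D0) ?(ltW AB0)//.
  rewrite -(@powR_inv1 _ (A + B)) ?(ltW AB0)// -powRrM mulN1r opprB mulrAC
    -powRD.
    by rewrite (_ : 1 - p + p = 1) ?powRr1 ?(ltW D0) 1?mulrC//; ring.
  by rewrite (gt_eqF D0) implybT.
move: H; rewrite !E// -mulrDr mulrC mulr_powRB1 ?(ltW AB0)//; last lra.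
move=> H; rewrite leNgt; apply/negP => SAB.
have K : (A + B) `^ p < S `^ p.
  by apply: gt0_ltr_powR; rewrite ?nnegrE ?(ltW AB0)//; lra.
by move: K; rewrite ltNge H.
Qed.

Lemma weighted_norm_metric p W : 1 < p -> (forall n, (0 < n)%N -> 0 < W n) ->
  is_metric (fun x y => weighted_norm p W (x - y)).
Proof.
move=> p1 W0; split.
- by move=> x y; exact: weighted_norm_ge0.
- move=> x y; split => [/(weighted_norm_eq0 p1 W0)/eqP|->].
    by rewrite subr_eq0 => /eqP.
  by rewrite subrr weighted_norm0.
- by move=> x y; rewrite -weighted_normN opprB.
- move=> x y z; rewrite (_ : x - z = (x - y) + (y - z)) ?ler_weighted_normD//.
  by rewrite addrA subrK.
Qed.

Lemma rate_function_powR p : 1 < p -> rate_function (fun t : R => t `^ p).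
Proof.
move=> p1; split.
- by move=> t _; exact: powR_ge0.
- by rewrite powR0//; apply/eqP; lra.
- by move=> x y t x0 y0 xy t0 t1; exact: powR_strictly_convex.
Qed.

(** Equality forces the W-norm to vanish, so the set of optimizers is {0}. The distance to it is the
    W-norm itself, whose p-th power is the remainder term. *)
Lemma improved_hardy_stable p a W : 1 < p ->
  (forall n, (0 < n)%N -> 0 < W n) ->
  (forall x, (wsum p W x <= h a p x)%E) ->
  Psi_stable (fun t : R => t `^ p) (hardy_E a p) (hardy_F a p).
Proof.
move=> p1 W0 HW; have p0 : p != 0 by apply/eqP; lra.
have Efin x : hardy_E a p x \is a fin_num.
  have [_ [N xN]] := H10_supp x.
  by rewrite /hardy_E /hardy_sum (wsumE _ p0 xN).
have HW' x : ((weighted_norm p W x `^ p)%:E <= hardy_F a p x - hardy_E a p x)%E.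
  by rewrite weighted_norm_powR//; exact: HW.
have EF x : (hardy_E a p x <= hardy_F a p x)%E.
  by rewrite -sube_ge0 ?Efin//; apply: le_trans (HW' x);
    rewrite lee_fin powR_ge0.
have XoptE : Xopt (hardy_E a p) (hardy_F a p) = [set 0]%classic.
  apply/seteqP; split => x /=.
    move=> [xE _]; have := HW' x; rewrite -xE subee ?Efin// lee_fin => nx.
    apply: (weighted_norm_eq0 p1 W0); apply/eqP.
    have : weighted_norm p W x `^ p == 0 by rewrite eq_le nx powR_ge0.
    by rewrite powR_eq0 => /andP[].
  move=> ->; have F0 : hardy_F a p (0 : H10 R) = 0%E.
    by rewrite /hardy_F (@energyE _ p a (0 : H10 R) 0)//= big_nil.
  by rewrite /Xopt/= F0 /hardy_E /hardy_sum (@wsumE _ p _ (0 : H10 R) 0)//=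
    big_nil mule0.
exists (fun x y => weighted_norm p W (x - y)); split.
  exact: weighted_norm_metric.
split => //.
- exact: rate_function_powR.
- by move=> x; have := Efin x; rewrite fin_numElt => /andP[].
- move=> x _; rewrite XoptE /dist_to image_set1 ereal_inf1/= subr0.
  exact: HW'.
Qed.

End weighted_lp_metric.

(** * Assembly: the improved inequality, subcriticality and stability *)

Theorem theorem4p12 (R : realType) (p alpha : R)
    (hp : 1 < p) (halpha : 0 <= alpha) (halphap : alpha != p - 1) :
  (exists W : nat -> R, (forall n : nat, (0 < n)%N -> 0 < W n) /\
     forall u : H10 R,
       (\sum_(1 <= n <oo) (`|u n - u n.-1| `^ p * n%:R `^ alpha)%:E
        - (hardy_const alpha p)%:E
          * \sum_(1 <= n <oo) (`|u n| `^ p * n%:R `^ (alpha - p))%:E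
        >= \sum_(1 <= n <oo) (`|u n| `^ p * W n)%:E)%E) /\
  subcritical p (h alpha p) /\
  Psi_stable (fun t : R => t `^ p) (hardy_E alpha p) (hardy_F alpha p).
Proof.
have p0 : p != 0 by apply/eqP; lra.
have [P [Q PQ]] := edge_weights_exist hp halpha halphap.
set c := `|(p - 1 - alpha) / p| `^ p in PQ.
pose W n := P n - Q n.+1 - c * n%:R `^ (alpha - p).
have W0 n : (0 < n)%N -> 0 < W n by case: PQ => _ _ PQ n0; rewrite subr_gt0 PQ.
(* The edge weights give the improvement over the explicit constant c. Passing to the sharp
   constant, which is at most c, can only enlarge the difference. *)
have hc : hardy_const alpha p <= c.
  by apply: hardy_const_le => //; rewrite divfK.
have HW (u : H10 R) : (wsum p W u <= h alpha p u)%E.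
  have [u0 [N uN]] := H10_supp u.
  rewrite /h /hardy_sum !(wsumE _ p0 uN) (energyE _ p0 uN) -EFinM -EFinB lee_fin.
  rewrite lerBrDr; apply: le_trans (energy_ge_edge_weights p0 PQ u0 (uN _ (leqnn N))).
  rewrite mulr_sumr -big_split/=; apply: ler_sum => n _.
  rewrite /W mulrCA -mulrDr ler_wpM2l ?powR_ge0//.
  have : hardy_const alpha p * n%:R `^ (alpha - p) <= c * n%:R `^ (alpha - p).
    by rewrite ler_wpM2r// powR_ge0.
  by move=> H; rewrite -[leRHS](subrK (c * n%:R `^ (alpha - p))) lerD2l.
split; first by exists W; split.
split; last exact: improved_hardy_stable W0 HW.
exists W; split => // u; have [u0 [N uN]] := H10_supp u.
by rewrite sube_ge0 ?HW// (wsumE _ p0 uN).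
Qed.
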